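(* Let $a>b>0$ with $a^2-b^2=1$, let $D=\{z=x+iy\in\mathbb{C} : b^2x^2+a^2y^2<a^2b^2\}$, and let $\rho=(a+b)^2$. For $n=0,1,2,\dots$ put $$P_n(z)=2\sqrt{\frac{n+1}{\pi}}\left(\rho^{n+1}-\rho^{-n-1}\right)^{-1/2}U_n(z).$$ Then for all $n,m\in\{0,1,2,\dots\}$ $$\iint_{D}P_n(z)\,\overline{P_m(z)}\,dx\,dy=\delta_{n,m},$$ and, for all $n$, $$\iint_{D}|T_n'(z)|^2\,dx\,dy=\frac{n\pi}{4}\left(\rho^n-\rho^{-n}\right).$$
   Context: $T_n(z)=\cos(n\cos^{-1}z)$, $n=0,1,2,\dots$, is the Tchebychev polynomial of degree $n$, and $U_n(z)=\frac{T_{n+1}'(z)}{n+1}=\frac{\sin((n+1)\cos^{-1}z)}{\sqrt{1-z^2}}$ is the Tchebychev polynomial of the second kind of degree $n$. $\delta_{n,m}$ is the Kronecker symbol. $D$ is the interior of an ellipse with semi-axes $a,b$ and foci $\pm1$. *)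

(* Defs.v *)
From HB Require Import structures.
From mathcomp Require Import all_boot all_order all_algebra.
From mathcomp Require Import all_classical all_reals all_analysis.
From mathcomp Require Import complex.
From mathcomp Require Import ring lra.

Set Implicit Arguments.
Unset Strict Implicit.
Unset Printing Implicit Defensive.

Import Order.TTheory GRing.Theory Num.Theory.
Import numFieldNormedType.Exports.

Local Open Scope classical_set_scope.
Local Open Scope ring_scope.
Local Open Scope complex_scope.

Section ComplexCosine.
Variable R : realType.
Implicit Types z w : R[i].

Definition cexp z : R[i] :=
  (expR (complex.Re z) * cos (complex.Im z))
    +i* (expR (complex.Re z) * sin (complex.Im z)).

Definition ccos z : R[i] := (cexp ('i * z) + cexp (- ('i * z))) / 2%:R.

Lemma cexp0 : cexp 0 = 1.
Proof. by rewrite /cexp /= expR0 cos0 sin0 !mul1r. Qed.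

Lemma cexpD z w : cexp (z + w) = cexp z * cexp w.
Proof.
case: z w => [a b] [c d]; rewrite /cexp /= expRD cosD sinD.
by apply/eqP; rewrite eq_complex /=; apply/andP; split; apply/eqP; ring.
Qed.

Lemma ccos_real (x : R) : ccos x%:C = (cos x)%:C.
Proof.
rewrite /ccos; apply: (canLR (mulfK _)); first by rewrite pnatr_eq0.
have -> : 2%:R = 2%:R%:C :> R[i] by rewrite rmorph_nat.
rewrite /cexp /=; simpc; rewrite /= expR0 cosN sinN.
by apply/eqP; rewrite eq_complex /=; apply/andP; split; apply/eqP; ring.
Qed.

Lemma ccos_rec n w :
  ccos (n.+2%:R * w) = 2%:R * ccos w * ccos (n.+1%:R * w) - ccos (n%:R * w).
Proof.
rewrite /ccos !mulrA ![_ * _%:R]mulrC -!mulrA.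
set v := 'i * w.
have e k : k.+1%:R * v = k%:R * v + v by rewrite -natr1 mulrDl mul1r.
rewrite !e !opprD !cexpD.
have vV : cexp v * cexp (- v) = 1 by rewrite -cexpD subrr cexp0.
set u := cexp v in vV *; set u' := cexp (- v) in vV *.
set s := cexp (_ * v); set s' := cexp (- _).
transitivity (((u + u') * (s * u + s' * u') - (u * u') * (s + s')) / 2%:R).
  by field.
by rewrite vV; field.
Qed.

End ComplexCosine.

Section Chebyshev.
Variable R : realType.

(* T_n(z) = cos (n arccos z) on the whole complex plane; w is any value of
   arccos z, so no branch has to be chosen. *)
Definition is_chebT (n : nat) (p : {poly R[i]}) : Prop :=
  forall z w : R[i], ccos w = z -> p.[z] = ccos (n%:R * w).

Lemma is_chebT_ex n : exists p, is_chebT n p.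
Proof.
suff [p [q [pP _]]] : exists p q, is_chebT n p /\ is_chebT n.+1 q by exists p.
elim: n => [|n [p [q [pP qP]]]].
  exists 1, 'X; split => z w <-; [|by rewrite hornerX mul1r].
  by rewrite hornerC mul0r; have := @ccos_real R 0; rewrite cos0 => ->.
exists q, (2%:R *: ('X * q) - p); split => // z w zw.
by rewrite hornerD hornerN hornerZ hornerM hornerX (pP _ _ zw) (qP _ _ zw) ccos_rec zw mulrA.
Qed.

Lemma is_chebT_uniq n p q : is_chebT n p -> is_chebT n q -> p = q.
Proof.
move=> pP qP; apply/eqP; rewrite -subr_eq0; apply/negPn/negP => r0.
pose s := [seq (k.+1%:R^-1 : R)%:C | k <- iota 0 (size (p - q))].
suff : (size s < size (p - q)%R)%N by rewrite size_map size_iota ltnn.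
apply: max_poly_roots => //.
- apply/allP => _ /mapP[k _ ->]; rewrite rootE !hornerE subr_eq0.
  have k1 : -1 <= (k.+1%:R^-1 : R) <= 1.
    rewrite (le_trans (lerN10 _)) ?invr_ge0//= invf_le1 ?ltr0n//.
    by rewrite ler1n.
  have e : ccos (acos (k.+1%:R^-1 : R))%:C = (k.+1%:R^-1 : R)%:C.
    by rewrite ccos_real acosK.
  by rewrite (pP _ _ e) (qP _ _ e).
- rewrite map_inj_uniq ?iota_uniq// => i j /complexI /invr_inj /eqP.
  by rewrite eqr_nat => /eqP[].
Qed.

Definition chebT (n : nat) : {poly R[i]} := sval (cid (is_chebT_ex n)).

Lemma chebTP n : is_chebT n (chebT n).
Proof. exact: svalP. Qed.

Definition chebU (n : nat) : {poly R[i]} := n.+1%:R^-1 *: (chebT n.+1)^`().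

End Chebyshev.

Section DoubleIntegral.
Variable R : realType.

Local Notation mu := (@lebesgue_measure R).

(* Rintegral returns junk on non-integrable functions; it is only used here for
   integrands polynomial in x and y on a bounded set D. *)
Definition iint (D : set R[i]) (f : R[i] -> R[i]) : R[i] :=
  let E := [set p : R * R | D (p.1 +i* p.2)] in
  (\int[(mu \x mu)%E]_(p in E) complex.Re (f (p.1 +i* p.2)))
    +i* (\int[(mu \x mu)%E]_(p in E) complex.Im (f (p.1 +i* p.2))).

End DoubleIntegral.

(* Main.v *)
Require Import Defs.
From HB Require Import structures.
From mathcomp Require Import all_boot all_order all_algebra.
From mathcomp Require Import all_classical all_reals all_analysis.
From mathcomp Require Import complex.
From mathcomp Require Import measurable_realfun.
From mathcomp Require Import ring lra.

(** Everything reduces to the integrals over [D] of [T_n' * conj T_m'], because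
    [U_n] is [T_(n+1)' / (n+1)].  These are computed by Green's theorem: for
    polynomials [f] and [g],
      [2 * iint_D f' * conj g' = i * (contour integral of f * conj (dg))]
    on the boundary ellipse.  The boundary is the image of a horizontal line
    under the complex cosine: with [s = ln (a + b)] one has [a = cosh s] and
    [b = sinh s], so that [a cos t + i b sin t = cos (t - i s)] and therefore
      [T_n (a cos t + i b sin t) = cosh (n s) cos (n t) + i sinh (n s) sin (n t)].
    The contour integral becomes an integral of products of trigonometric
    functions over a period, and their orthogonality leaves
    [delta_(n,m) * m * pi * cosh (m s) * sinh (m s)] for the area integral,
    which equals [delta_(n,m) * (m * pi / 4) * (rho^m - rho^-m)].

    Since only polynomial integrands occur, Green's theorem is needed for
    polynomials in two real variables and for one curve.  The part with
    [d/dy] is Fubini with vertical slices, the fundamental theorem of calculus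
    on each slice, and the substitution [x = a cos t] (lemma [green_dy]).  The
    part with [d/dx] follows from it without a second slicing (lemma
    [green_dx]).  The complex form is then obtained by writing [f = u + i v]
    and [g = p + i q] with real polynomials that satisfy the Cauchy-Riemann
    equations (lemmas [cauchy_riemann] and [green_cauchy_riemann]). *)

Import Order.TTheory GRing.Theory Num.Theory.
Import numFieldNormedType.Exports.

Local Open Scope classical_set_scope.
Local Open Scope ring_scope.
Local Open Scope complex_scope.

Set Implicit Arguments.
Unset Strict Implicit.
Unset Printing Implicit Defensive.

(** * Real polynomials in two variables *)

Section BivariatePolynomials.
Variable R : realType.
Implicit Types (p q : {poly {poly R}}) (x y : R).

(** Elements of [{poly {poly R}}] are read with [x] as the inner variable and
    [y] as the outer one, so that fixing [x] leaves a one-variable polynomial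
    in [y], which is what integration along a vertical slice needs. *)
Definition bieval p x y : R := (map_poly (horner_eval x) p).[y].

Definition dx p : {poly {poly R}} := map_poly (@deriv R) p.
Definition dy p : {poly {poly R}} := deriv p.

Lemma bievalD p q x y : bieval (p + q) x y = bieval p x y + bieval q x y.
Proof. by rewrite /bieval rmorphD hornerD. Qed.

Lemma bievalN p x y : bieval (- p) x y = - bieval p x y.
Proof. by rewrite /bieval rmorphN hornerN. Qed.

Lemma bievalM p q x y : bieval (p * q) x y = bieval p x y * bieval q x y.
Proof. by rewrite /bieval rmorphM hornerM. Qed.

Lemma bievalC (c : {poly R}) x y : bieval c%:P x y = c.[x].
Proof. by rewrite /bieval map_polyC hornerC. Qed.

Lemma bievalX x y : bieval 'X x y = y.
Proof. by rewrite /bieval map_polyX hornerX. Qed.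

Lemma bieval0 x y : bieval 0 x y = 0.
Proof. by rewrite -polyC0 bievalC horner0. Qed.

Lemma bieval1 x y : bieval 1 x y = 1.
Proof. by rewrite -polyC1 bievalC hornerC. Qed.

Definition bievalE :=
  (bieval0, bieval1, bievalD, bievalN, bievalM, bievalC, bievalX).

Lemma dx0 : dx 0 = 0.
Proof. exact: raddf0. Qed.

Definition dy0 : dy 0 = 0 := deriv0 _.

Lemma dxC (c : {poly R}) : dx c%:P = (deriv c)%:P.
Proof. by rewrite /dx map_polyC. Qed.

Lemma dxX : dx 'X = 0.
Proof.
apply/polyP => i; rewrite coef_map coefX coef0 /=.
by case: (i == 1)%N; rewrite ?mulr1n ?mulr0n /= -?polyC1 ?derivC ?deriv0.
Qed.

Lemma dxD p q : dx (p + q) = dx p + dx q.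
Proof. exact: raddfD. Qed.

Lemma dxB p q : dx (p - q) = dx p - dx q.
Proof. exact: raddfB. Qed.

Lemma dxN p : dx (- p) = - dx p.
Proof. exact: raddfN. Qed.

Lemma dxM p q : dx (p * q) = dx p * q + p * dx q.
Proof.
apply/polyP => i; rewrite coefD !coefM coef_map coefM /= raddf_sum -big_split /=.
by apply: eq_bigr => j _; rewrite derivM !coef_map.
Qed.

Definition dyD p q : dy (p + q) = dy p + dy q := derivD p q.
Definition dyB p q : dy (p - q) = dy p - dy q := derivB p q.
Definition dyN p : dy (- p) = - dy p := derivN p.
Definition dyM p q : dy (p * q) = dy p * q + p * dy q := derivM p q.
Definition dyC (c : {poly R}) : dy c%:P = 0 := derivC c.
Definition dyX : dy 'X = 1 := derivX _.

Lemma dx_dy p : dx (dy p) = dy (dx p).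
Proof.
apply/polyP => i; rewrite coef_map !coef_deriv coef_map /=.
by rewrite derivMn.
Qed.

(** Polynomial antiderivatives exist because [R] has characteristic 0. *)
Lemma dy_surj p : exists q, dy q = p.
Proof.
exists (\poly_(i < (size p).+1) (i%:R^-1 *: p`_i.-1)).
apply/polyP => i; rewrite coef_deriv coef_poly ltnS /=.
case: ltnP => [ip|pi]; last by rewrite mul0rn nth_default.
by rewrite -scaler_nat scalerA divff ?scale1r // pnatr_eq0.
Qed.

(** The regularity properties of polynomial functions needed below
    (continuity along a curve, measurability, boundedness on a box) hold for
    constants and coordinates and are stable under sums and products; this
    principle reduces each of them to these five checks. *)
Lemma bieval_ind (P : (R -> R -> R) -> Prop) :
  (forall c, P (fun _ _ => c)) -> P (fun x _ => x) -> P (fun _ y => y) ->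
  (forall F G, P F -> P G -> P (fun x y => F x y + G x y)) ->
  (forall F G, P F -> P G -> P (fun x y => F x y * G x y)) ->
  forall p, P (bieval p).
Proof.
move=> Pc Px Py PD PM; elim/poly_ind => [|p c Pp].
  by rewrite (_ : bieval 0 = fun _ _ => 0)//; apply/funext=> x;
    apply/funext=> y; rewrite bieval0.
rewrite (_ : bieval _ = fun x y => bieval p x y * y + c.[x]); last first.
  by apply/funext=> x; apply/funext=> y; rewrite !bievalE.
apply: (PD); first exact: PM.
elim/poly_ind: c => [|c d Pc'].
  by rewrite (_ : (fun _ => _) = fun _ _ => 0)//; apply/funext=> x;
    apply/funext=> y; rewrite horner0.
rewrite (_ : (fun _ => _) = fun x _ => c.[x] * x + d); last first.
  by apply/funext=> x; apply/funext=> y; rewrite !hornerE.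
by apply: (PD); [exact: PM|exact: Pc].
Qed.

Lemma continuous_bieval p (f g : R -> R) : continuous f -> continuous g ->
  continuous (fun t => bieval p (f t) (g t)).
Proof.
move=> cf cg.
apply: (bieval_ind (P := fun F => continuous (fun t => F (f t) (g t)))) => //.
- by move=> c t; exact: cvg_cst.
- by move=> F G cF cG t; exact: (cvgD (cF t) (cG t)).
- by move=> F G cF cG t; exact: (cvgM (cF t) (cG t)).
Qed.

Lemma measurable_bieval p :
  measurable_fun setT (fun z : R * R => bieval p z.1 z.2).
Proof.
apply: (bieval_ind (P := fun F => measurable_fun setT (fun z : R * R => F z.1 z.2))).
- by move=> c; exact: measurable_cst.
- exact: measurable_fst.
- exact: measurable_snd.
- by move=> F G mF mG; exact: measurable_funD.
- by move=> F G mF mG; exact: measurable_funM.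
Qed.

Lemma bounded_bieval p (a b : R) : exists M, forall x y,
  `|x| <= a -> `|y| <= b -> `|bieval p x y| <= M.
Proof.
apply: (bieval_ind (P := fun F => exists M, forall x y,
  `|x| <= a -> `|y| <= b -> `|F x y| <= M)).
- by move=> c; exists `|c|.
- by exists a.
- by exists b.
- move=> F G [M FM] [N GN]; exists (M + N) => x y xa yb.
  by rewrite (le_trans (ler_normD _ _))// lerD ?FM ?GN.
- move=> F G [M FM] [N GN]; exists (M * N) => x y xa yb.
  by rewrite normrM ler_pM ?FM ?GN.
Qed.

Lemma is_derive_bieval p (f g : R -> R) (t df dg : R) :
  is_derive t 1 f df -> is_derive t 1 g dg ->
  is_derive t 1 (fun s => bieval p (f s) (g s))
    (bieval (dx p) (f t) (g t) * df + bieval (dy p) (f t) (g t) * dg).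
Proof.
move=> dfP dgP; elim/poly_ind: p => [|p c IH].
  rewrite (_ : (fun _ => _) = cst 0); last first.
    by apply/funext => s; rewrite bieval0.
  rewrite dx0 dy0 !bieval0 !mul0r addr0.
  exact: is_derive_cst.
rewrite (_ : (fun _ => _) =
  (fun s => bieval p (f s) (g s)) * g + (horner c \o f)); last first.
  by apply/funext => s; rewrite !bievalE.
have dcf := is_derive1_comp (is_derive_poly c (f t)) dfP.
apply: is_derive_eq.
rewrite dxD dxM dxX dxC dyD dyM dyX dyC !bievalE.
rewrite /GRing.scale /=; ring.
Qed.

End BivariatePolynomials.

(** * The ellipse and its slices *)

Section EllipseIntegrals.
Variable R : realType.
Local Notation mu := (@lebesgue_measure R).
Implicit Types (p q : {poly {poly R}}) (a b : R).

Lemma FTC_is_derive (F h : R -> R) a b : a <= b ->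
  (forall x : R, is_derive x 1 F (h x)) -> continuous h ->
  (\int[mu]_(x in `[a, b]) (h x)%:E = (F b - F a)%:E)%E.
Proof.
rewrite le_eqVlt => /predU1P[->|ab] dF ch.
  by rewrite set_itv1 integral_set1 subrr.
have cF : continuous F.
  by move=> x; apply/differentiable_continuous/derivable1_diffP; case: (dF x).
rewrite (continuous_FTC2 (F := F)) ?EFinB//.
- exact: continuous_subspaceT.
- split.
  + by move=> x _; case: (dF x).
  + exact/cvg_at_right_filter/cF.
  + exact/cvg_at_left_filter/cF.
- by move=> x _; rewrite derive1E; apply: derive_val.
Qed.

Lemma integrable_itv (h : R -> R) a b : continuous h ->
  mu.-integrable `[a, b] (EFin \o h).
Proof.
move=> ch; apply: continuous_compact_integrable; first exact: segment_compact.
exact: continuous_subspaceT.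
Qed.

Definition ellipse a b : set (R * R) :=
  [set z | b ^+ 2 * z.1 ^+ 2 + a ^+ 2 * z.2 ^+ 2 < a ^+ 2 * b ^+ 2].

Definition ellipse_int a b p : R :=
  \int[(mu \x mu)%E]_(z in ellipse a b) bieval p z.1 z.2.

Lemma measurable_ellipse a b : measurable (ellipse a b).
Proof.
pose f (z : R * R) := b ^+ 2 * z.1 ^+ 2 + a ^+ 2 * z.2 ^+ 2.
have mf : measurable_fun setT f.
  apply: measurable_funD; apply: measurable_funM => //; apply: measurable_funX.
  - exact: measurable_fst.
  - exact: measurable_snd.
rewrite (_ : ellipse a b = setT `&` f @^-1` `]-oo, a ^+ 2 * b ^+ 2[).
  exact: mf.
by rewrite setTI; apply/seteqP; split => z; rewrite /= in_itv.
Qed.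

Lemma ellipse_box a b z : 0 < a -> 0 < b -> ellipse a b z ->
  `|z.1| <= a /\ `|z.2| <= b.
Proof.
move=> a0 b0; rewrite /ellipse/= => zE.
have {zE} : (b * z.1) ^+ 2 + (a * z.2) ^+ 2 < (a * b) ^+ 2 by rewrite !exprMn.
move=> zE.
have norm_le (c d w : R) : 0 < c -> 0 < d -> (c * w) ^+ 2 <= (c * d) ^+ 2 -> `|w| <= d.
  move=> c0 d0; rewrite !exprMn ler_pM2l ?exprn_gt0// -[w ^+ 2]real_normK ?num_real//.
  by rewrite ler_sqr// nnegrE ltW.
split.
- apply: (norm_le b) => //; rewrite [b * a]mulrC.
  by apply: le_trans (ltW zE); rewrite lerDl sqr_ge0.
- apply: (norm_le a) => //.
  by apply: le_trans (ltW zE); rewrite lerDr sqr_ge0.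
Qed.

(** A polynomial is bounded on the box that contains the ellipse, and that box
    has finite area. *)
Lemma integrable_bieval a b p : 0 < a -> 0 < b ->
  (mu \x mu)%E.-integrable (ellipse a b)
    (EFin \o (fun z => bieval p z.1 z.2)).
Proof.
move=> a0 b0; apply: measurable_bounded_integrable.
- exact: measurable_ellipse.
- apply: (@le_lt_trans _ _ ((mu \x mu)%E (`[- a, a] `*` `[- b, b]))).
    apply: le_measure; rewrite ?inE.
    + exact: measurable_ellipse.
    + by apply: measurableX.
    + move=> z /(ellipse_box a0 b0)[za zb].
      by split; rewrite /= in_itv/= -ler_norml.
  rewrite product_measure1E//= !lebesgue_measure_itv/=.
  by case: ifP => _; case: ifP => _; rewrite ?mule0 ?mul0e// -!EFinD -EFinM ltry.
- exact: measurable_funTS (measurable_bieval p).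
- have [M bM] := bounded_bieval p a b.
  exists M; split; first exact: num_real.
  move=> N MN z /(ellipse_box a0 b0)[za zb] /=.
  by rewrite (le_trans (bM _ _ za zb))// ltW.
Qed.

Lemma ellipse_intD a b p q : 0 < a -> 0 < b ->
  ellipse_int a b (p + q) = ellipse_int a b p + ellipse_int a b q.
Proof.
move=> a0 b0; rewrite /ellipse_int -RintegralD.
- by apply: eq_Rintegral => z _; rewrite bievalD.
- exact: measurable_ellipse.
- exact: integrable_bieval.
- exact: integrable_bieval.
Qed.

Lemma ellipse_intZ a b (c : R) p : 0 < a -> 0 < b ->
  ellipse_int a b (c%:P%:P * p) = c * ellipse_int a b p.
Proof.
move=> a0 b0; rewrite /ellipse_int -RintegralZl.
- by apply: eq_Rintegral => z _; rewrite !bievalE hornerC.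
- exact: measurable_ellipse.
- exact: integrable_bieval.
Qed.

(** Half the length of the slice of abscissa [x].  As [Num.sqrt] vanishes on
    negative numbers, this is [0] for [`|x| >= a], where the slice is empty;
    the formulas for slices then need no case distinction. *)
Definition half_height a b x : R := b * Num.sqrt (1 - (x / a) ^+ 2).

Lemma continuous_half_height a b : continuous (half_height a b).
Proof.
move=> x; apply: cvgM; first exact: cvg_cst.
apply: (@continuous_comp _ _ _ (fun x : R => 1 - (x / a) ^+ 2) Num.sqrt);
  last exact: sqrt_continuous.
apply: cvgB; first exact: cvg_cst.
apply: (@continuous_comp _ _ _ (fun x : R => x / a) (fun x => x ^+ 2)).
  exact: mulrr_continuous.
exact: exprn_continuous.
Qed.

Lemma ellipse_slice a b x y : 0 < a -> 0 < b ->
  ellipse a b (x, y) <-> y \in `]- half_height a b x, half_height a b x[.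
Proof.
move=> a0 b0; rewrite /ellipse /half_height/= in_itv/= -ltr_norml.
have -> : (b ^+ 2 * x ^+ 2 + a ^+ 2 * y ^+ 2 < a ^+ 2 * b ^+ 2) =
    ((y / b) ^+ 2 < 1 - (x / a) ^+ 2).
  rewrite -[RHS](ltr_pM2l (_ : 0 < a ^+ 2 * b ^+ 2)) ?mulr_gt0 ?exprn_gt0//.
  rewrite mulrBr mulr1 ltrBrDr addrC; congr (_ < _).
  by field; rewrite !gt_eqF.
rewrite -[`|y| < _](ltr_pM2l (_ : 0 < b^-1)) ?invr_gt0// mulKf ?gt_eqF//.
rewrite -{2}(gtr0_norm (_ : 0 < b^-1)) ?invr_gt0// -normrM mulrC.
(* For [s <= 0] both sides are absurd, the right-hand bound being [0]. *)
set s := 1 - _; have [s0|s0] := ltrP 0 s.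
  by rewrite -(ltr_sqrt _ s0) sqrtr_sqr.
rewrite ler0_sqrtr//; split; last by rewrite normr_lt0.
by move=> h; have := lt_le_trans h s0; rewrite ltNge sqr_ge0.
Qed.

End EllipseIntegrals.

(** * Green's theorem for polynomials on the ellipse *)

Section Green.
Variable R : realType.
Local Notation mu := (@lebesgue_measure R).
Implicit Types (p q : {poly {poly R}}) (a b : R) (h k : R -> R).

(** For an integrable [h] this is its integral over the period [[-pi, pi]],
    folded at [0].  On [[0, pi]] the map [cos] is decreasing, which is what the
    substitution in [green_dy] requires, and the two summands are the
    contributions of the upper and of the lower half of the ellipse. *)
Definition circle_int h : R := \int[mu]_(t in `[0, pi]) (h t + h (- t)).

Lemma is_derive_Mcos (c t : R) :
  is_derive t 1 (fun t => c * cos t) (- (c * sin t)).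
Proof. by apply: is_derive_eq; rewrite /GRing.scale/= mulrN. Qed.

Lemma is_derive_Msin (c t : R) : is_derive t 1 (fun t => c * sin t) (c * cos t).
Proof. by apply: is_derive_eq. Qed.

Lemma continuous_Mcos (c : R) : continuous (fun t => c * cos t).
Proof. by move=> t; apply: cvgM; [exact: cvg_cst|exact: continuous_cos]. Qed.

Lemma continuous_Msin (c : R) : continuous (fun t => c * sin t).
Proof. by move=> t; apply: cvgM; [exact: cvg_cst|exact: continuous_sin]. Qed.

Lemma continuous_fold h : continuous h -> continuous (fun t => h t + h (- t)).
Proof.
move=> ch t; apply: cvgD; first exact: ch.
by apply: (@continuous_comp _ _ _ -%R h); [exact: oppr_continuous|exact: ch].
Qed.

Lemma circle_intD h k : continuous h -> continuous k ->
  circle_int (fun t => h t + k t) = circle_int h + circle_int k.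
Proof.
move=> ch ck; rewrite /circle_int -RintegralD//.
- by apply: eq_Rintegral => t _; rewrite addrACA.
- by apply: integrable_itv; exact: continuous_fold.
- by apply: integrable_itv; exact: continuous_fold.
Qed.

(** [k t - k (- t)] is a primitive of [h t + h (- t)]. *)
Lemma circle_int_derive h k : (forall t : R, is_derive t 1 k (h t)) ->
  continuous h -> circle_int h = k pi - k (- pi).
Proof.
move=> dk ch; rewrite /circle_int /Rintegral.
have dkN (t : R) : is_derive t 1 (fun t => k t - k (- t)) (h t + h (- t)).
  have := is_deriveB (dk t) (is_derive1_comp (dk (- t)) (is_deriveNid t 1)).
  by rewrite mulrN1 opprK.
rewrite (FTC_is_derive (pi_ge0 R) dkN (continuous_fold ch))/=.
by rewrite oppr0 subrr subr0.
Qed.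

(** The fundamental theorem of calculus on the slice of abscissa [x]; for an
    empty slice both sides are [0]. *)
Lemma slice_int a b p x : 0 < a -> 0 < b ->
  (\int[mu]_y ((fun z => (bieval (dy p) z.1 z.2)%:E) \_ (ellipse a b)) (x, y) =
   (bieval p x (half_height a b x) - bieval p x (- half_height a b x))%:E)%E.
Proof.
move=> a0 b0; set Y := half_height a b x.
have Y0 : 0 <= Y by rewrite mulr_ge0 ?sqrtr_ge0// ltW.
have cf : continuous (fun y => bieval (dy p) x y).
  by apply: (@continuous_bieval _ _ (cst x) id) => t; [exact: cvg_cst|exact: cvg_id].
transitivity (\int[mu]_(y in `](- Y)%R, Y[) (bieval (dy p) x y)%:E)%E.
  rewrite [RHS]integral_mkcond; apply: eq_integral => y _; rewrite !patchE.
  have [yY|yY] := boolP (y \in `]- Y, Y[%classic).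
    by rewrite mem_set//; apply/(ellipse_slice _ _ a0 b0); rewrite inE in yY.
  rewrite memNset//; move/(ellipse_slice _ _ a0 b0) => yY'.
  by move/negP: yY; apply; rewrite inE.
have mf D : measurable_fun D (fun y => (bieval (dy p) x y)%:E).
  apply/measurable_EFinP/measurable_funTS.
  exact: continuous_measurable_fun.
rewrite integral_itv_bndo_bndc// integral_itv_obnd_cbnd//.
apply: (FTC_is_derive (F := fun y => bieval p x y)) => //.
  by rewrite (le_trans _ Y0)// oppr_le0.
move=> y; have := is_derive_bieval p (is_derive_cst x y 1) (is_derive_id y 1).
by rewrite mulr0 mulr1 add0r.
Qed.

Lemma half_height_cos a b t : 0 < a -> 0 <= t <= pi ->
  half_height a b (a * cos t) = b * sin t.
Proof.
move=> a0 tpi; rewrite /half_height mulrAC divff ?gt_eqF// mul1r -sin2cos2.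
by rewrite sqrtr_sqr ger0_norm// sin_ge0_pi.
Qed.

(** Fubini turns the area integral into the integral over [x] of the
    increments given by [slice_int], and [x = a cos t] parametrizes it: the end
    points of the slice become [b sin t] and [- b sin t = b sin (- t)], and
    [a sin t dt = - dx]. *)
Lemma green_dy a b p : 0 < a -> 0 < b ->
  ellipse_int a b (dy p) =
  circle_int (fun t => bieval p (a * cos t) (b * sin t) * (a * sin t)).
Proof.
move=> a0 b0; rewrite /ellipse_int /circle_int /Rintegral; congr fine.
pose Y := half_height a b.
pose G x := bieval p x (Y x) - bieval p x (- Y x).
have cY : continuous Y by exact: continuous_half_height.
have cG : continuous G.
  move=> x; apply: cvgB.
    by apply: (@continuous_bieval _ _ id) => // ?; exact: cvg_id.
  apply: (@continuous_bieval _ _ id) => [?|z]; first exact: cvg_id.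
  by apply: cvgN; exact: cY.
rewrite integral_mkcond -integral12_prod_meas1/=; last first.
  rewrite -integrable_mkcond; last exact: measurable_ellipse.
  exact: integrable_bieval.
rewrite /fubini_F.
transitivity (\int[mu]_x (G x)%:E)%E.
  by apply: eq_integral => x _; exact: slice_int.
(* Outside [[-a, a]] the half-height vanishes, hence so does [G]. *)
transitivity (\int[mu]_(x in `[(- a)%R, a]) (G x)%:E)%E.
  rewrite [RHS]integral_mkcond; apply: eq_integral => x _; rewrite patchE.
  case: ifPn => //; rewrite notin_setE/= in_itv/= -ler_norml => /negP.
  rewrite -ltNge => ax; rewrite /G.
  suff -> : Y x = 0 by rewrite oppr0 subrr.
  rewrite /Y /half_height ler0_sqrtr ?mulr0// subr_le0.
  rewrite -[_ ^+ 2]real_normK ?num_real// exprn_ege1//.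
  by rewrite normrM normfV (gtr0_norm a0) ler_pdivlMr ?mul1r// ltW.
have dF := is_derive_Mcos a.
have F' : derive1 (fun t => a * cos t) = (fun t => - (a * sin t)).
  by apply/funext => t; rewrite derive1E (@derive_val _ _ _ _ _ _ _ (dF t)).
have cF := @continuous_Mcos a.
have cF' : continuous (fun t => - (a * sin t)).
  by move=> t; apply: cvgN; exact: continuous_Msin.
have := @integration_by_substitution_decreasing R (fun t => a * cos t) G 0 pi.
rewrite cos0 cospi mulr1 mulrN1 => -> //.
- apply: eq_integral => t; rewrite inE/= in_itv/= => tpi; congr EFin.
  rewrite F' !fctE opprK cosN sinN !mulrN -mulrBl.
  by rewrite /G /Y half_height_cos.
- exact: pi_ge0.
- by move=> x y x0 y0 xy; rewrite ltr_pM2l// ltr_cos.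
- by move=> t _; rewrite F'; exact: cF'.
- by rewrite F'; apply/cvg_ex; eexists; apply: cvg_at_right_filter; exact: cF'.
- by rewrite F'; apply/cvg_ex; eexists; apply: cvg_at_left_filter; exact: cF'.
- split.
  + by move=> t _; case: (dF t).
  + exact/cvg_at_right_filter/cF.
  + exact/cvg_at_left_filter/cF.
- exact: continuous_subspaceT.
Qed.

Lemma continuous_bieval_ellipse a b p :
  continuous (fun t => bieval p (a * cos t) (b * sin t)).
Proof.
by apply: continuous_bieval; [exact: continuous_Mcos|exact: continuous_Msin].
Qed.

Definition is_derive_bieval_ellipse a b p (t : R) :
    is_derive t 1 (fun t => bieval p (a * cos t) (b * sin t)) _ :=
  is_derive_bieval p (is_derive_Mcos a t) (is_derive_Msin b t).

End Green.

(** * Cauchy-Riemann equations and the complex form of Green's theorem *)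

Section HolomorphicGreen.
Variable R : realType.
Implicit Types (p q u v : {poly {poly R}}) (a b : R).

(** Write [p = dP/dy].  By [green_dy] applied to [dP/dx], the area integral is
    the contour integral of [(dP/dx) * a sin t].  Along the ellipse the
    derivative of [P] is [- (dP/dx) * a sin t + p * b cos t], and its integral
    over a period is [0]. *)
Lemma green_dx a b p : 0 < a -> 0 < b ->
  ellipse_int a b (dx p) =
  circle_int (fun t => bieval p (a * cos t) (b * sin t) * (b * cos t)).
Proof.
move=> a0 b0; have [P <-] := dy_surj p; rewrite dx_dy green_dy//.
pose h t := bieval (dx P) (a * cos t) (b * sin t) * - (a * sin t)
  + bieval (dy P) (a * cos t) (b * sin t) * (b * cos t).
have ch : continuous h.
  move=> t; apply: cvgD; apply: cvgM.
  - exact: (@continuous_bieval_ellipse _ a b).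
  - by apply: cvgN; exact: continuous_Msin.
  - exact: (@continuous_bieval_ellipse _ a b).
  - exact: continuous_Mcos.
have h0 : circle_int h = 0.
  rewrite (circle_int_derive (is_derive_bieval_ellipse a b P) ch).
  by rewrite cosN sinN sinpi oppr0 subrr.
rewrite -[LHS]addr0 -h0 -circle_intD//; last first.
  by move=> t; apply: cvgM; [exact: (@continuous_bieval_ellipse _ a b)|exact: continuous_Msin].
by congr circle_int; apply/funext => t; rewrite /h mulrN addNKr.
Qed.

(** With [f = u + i v] and [g = p + i q] the integrand is the real part of
    [f' * conj g'], since [f' = du/dx + i dv/dx].  Its double is the divergence
      [d/dx (u dp/dx + v dq/dx) + d/dy (v dp/dx - u dq/dx)],
    the second derivatives cancelling by the Cauchy-Riemann equations; on the
    boundary the same equations recombine the flux into [u dq - v dp], where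
    [dp] and [dq] are the derivatives of [p] and [q] along the curve.
    The imaginary part is covered as well, by applying this to [i g], that is,
    to the pair [(- q, p)]. *)
Lemma green_cauchy_riemann a b u v p q (dp dq : R -> R) : 0 < a -> 0 < b ->
  dx p = dy q -> dy p = - dx q -> dx u = dy v -> dy u = - dx v ->
  (forall t : R, is_derive t 1 (fun t => bieval p (a * cos t) (b * sin t)) (dp t)) ->
  (forall t : R, is_derive t 1 (fun t => bieval q (a * cos t) (b * sin t)) (dq t)) ->
  ellipse_int a b (dx u * dx p + dx v * dx q) *+ 2 =
  circle_int (fun t => bieval u (a * cos t) (b * sin t) * dq t
                     - bieval v (a * cos t) (b * sin t) * dp t).
Proof.
move=> a0 b0 pq1 pq2 uv1 uv2 dpP dqP.
rewrite mulr2n -ellipse_intD//.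
have -> : dx u * dx p + dx v * dx q + (dx u * dx p + dx v * dx q) =
    dx (u * dx p + v * dx q) + dy (v * dx p - u * dx q).
  rewrite dxD dyB !dxM !dyM uv2 -uv1 -!dx_dy -pq1 pq2.
  rewrite (_ : dx (- dx q) = - dx (dx q)) ?dxN//.
  ring.
rewrite ellipse_intD// green_dx// green_dy//.
rewrite -circle_intD; first last.
- by move=> t; apply: cvgM; [exact: (@continuous_bieval_ellipse _ a b)|exact: continuous_Msin].
- by move=> t; apply: cvgM; [exact: (@continuous_bieval_ellipse _ a b)|exact: continuous_Mcos].
congr circle_int; apply/funext => t.
have -> : dp t = bieval (dx p) (a * cos t) (b * sin t) * - (a * sin t)
    + bieval (dy p) (a * cos t) (b * sin t) * (b * cos t).
  by rewrite -(@derive_val _ _ _ _ _ _ _ (dpP t))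
    -(@derive_val _ _ _ _ _ _ _ (is_derive_bieval_ellipse a b p t)).
have -> : dq t = bieval (dx q) (a * cos t) (b * sin t) * - (a * sin t)
    + bieval (dy q) (a * cos t) (b * sin t) * (b * cos t).
  by rewrite -(@derive_val _ _ _ _ _ _ _ (dqP t))
    -(@derive_val _ _ _ _ _ _ _ (is_derive_bieval_ellipse a b q t)).
rewrite -pq1 pq2 !bievalE; ring.
Qed.

(** The induction step is [(u + i v) (x + i y) + c], so the real and imaginary
    parts are again polynomials in [x] and [y]. *)
Lemma cauchy_riemann (f : {poly R[i]}) : exists u v,
  [/\ forall x y, f.[x +i* y] = bieval u x y +i* bieval v x y,
      forall x y, (deriv f).[x +i* y] = bieval (dx u) x y +i* bieval (dx v) x y,
      dx u = dy v & dy u = - dx v].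
Proof.
elim/poly_ind: f => [|f c [u [v [fE f'E uv1 uv2]]]].
  exists 0, 0; rewrite dx0 dy0 oppr0 deriv0; split => // x y;
  by rewrite horner0 !bieval0.
have [X [dxX' dyX' bX]] : exists X : {poly {poly R}},
    [/\ dx X = 1, dy X = 0 & forall x y, bieval X x y = x].
  exists ('X%:P); split; first by rewrite dxC derivX.
    by rewrite dyC.
  by move=> x y; rewrite bievalC hornerX.
exists (u * X - v * 'X + (complex.Re c)%:P%:P),
       (u * 'X + v * X + (complex.Im c)%:P%:P).
have dx1 : dx (u * X - v * 'X + (complex.Re c)%:P%:P) = dx u * X + u - dx v * 'X.
  by rewrite dxD dxB !dxM dxX' dxX dxC derivC polyC0; ring.
have dx2 : dx (u * 'X + v * X + (complex.Im c)%:P%:P) = dx u * 'X + dx v * X + v.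
  by rewrite !dxD !dxM dxX' dxX dxC derivC polyC0; ring.
split.
- move=> x y; rewrite !hornerE fE !bievalE !bX !hornerC; case: c {dx1 dx2} => c d /=.
  by apply/eqP; rewrite eq_complex /=; apply/andP; split; apply/eqP; ring.
- move=> x y; rewrite dx1 dx2 derivD derivM derivX derivC !hornerE fE f'E.
  rewrite !bievalE !bX.
  by apply/eqP; rewrite eq_complex /=; apply/andP; split; apply/eqP; ring.
- by rewrite dx1 !dyD !dyM dyX' dyX dyC uv2 -uv1; ring.
- by rewrite dx2 !dyD dyN !dyM dyX' dyX dyC uv2 -uv1; ring.
Qed.

End HolomorphicGreen.

(** * Chebyshev polynomials on the boundary ellipse *)

Section ChebyshevOnEllipse.
Variable R : realType.
Implicit Types (a b s t : R) (n m : nat).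

Definition cosh s : R := (expR s + expR (- s)) / 2.
Definition sinh s : R := (expR s - expR (- s)) / 2.

Lemma ccosE t s :
  ccos (t +i* - s) = (cosh s * cos t) +i* (sinh s * sin t).
Proof.
rewrite /ccos; apply: (canLR (mulfK _)); first by rewrite pnatr_eq0.
have -> : 2%:R = 2%:R%:C :> R[i] by rewrite rmorph_nat.
rewrite /cexp /cosh /sinh /= !(mul0r, mul1r, add0r, sub0r, opprK, addr0) cosN sinN.
by apply/eqP; rewrite eq_complex /=; apply/andP; split; apply/eqP; field.
Qed.

(** The boundary point is [cos (t - i s)], and [T_n] multiplies the argument of
    the cosine by [n]. *)
Lemma chebT_ellipse n t s : (chebT R n).[(cosh s * cos t) +i* (sinh s * sin t)] =
  (cosh (n%:R * s) * cos (n%:R * t)) +i* (sinh (n%:R * s) * sin (n%:R * t)).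
Proof.
rewrite (@chebTP R n _ _ (ccosE t s)) -ccosE; congr ccos.
have -> : n%:R = n%:R%:C :> R[i] by rewrite rmorph_nat.
by apply/eqP; rewrite eq_complex /=; apply/andP; split; apply/eqP; ring.
Qed.

Lemma sin_int_pi (k : int) : sin (k%:~R * pi) = 0 :> R.
Proof.
have sin_nat n : sin (n%:R * pi) = 0 :> R.
  elim: n => [|n IH]; first by rewrite mul0r sin0.
  by rewrite -natr1 mulrDl mul1r sinDpi IH oppr0.
case: k => n; first exact: sin_nat.
by rewrite NegzE mulrNz mulNr sinN sin_nat oppr0.
Qed.

Lemma continuous_cosM (c k : R) : continuous (fun t => c * cos (k * t)).
Proof.
move=> t; apply: cvgM; first exact: cvg_cst.
apply: (@continuous_comp _ _ _ ( *%R k) cos); first exact: mulrl_continuous.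
exact: continuous_cos.
Qed.

Lemma is_derive_cosM (c k t : R) :
  is_derive t 1 (fun t => c * cos (k * t)) (- (c * k * sin (k * t))).
Proof. by apply: is_derive_eq; rewrite /GRing.scale/=; ring. Qed.

Lemma is_derive_sinM (c k t : R) :
  is_derive t 1 (fun t => c * sin (k * t)) (c * k * cos (k * t)).
Proof. by apply: is_derive_eq; rewrite /GRing.scale/=; ring. Qed.

Lemma circle_int_cos (c : R) (k : int) :
  circle_int (fun t => c * cos (k%:~R * t)) = c * (pi *+ 2) * (k == 0)%:R.
Proof.
have [->|k0] := eqVneq k 0.
  have -> : (fun t => c * cos (0%:~R * t)) = (fun=> c).
    by apply/funext => t; rewrite mul0r cos0 mulr1.
  have dc (t : R) : is_derive t 1 (fun t => c * t) c.
    by apply: is_derive_eq; rewrite /GRing.scale/= mulr1.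
  rewrite (circle_int_derive dc); last exact: cst_continuous.
  by rewrite mulr1; ring.
have k0' : k%:~R != 0 :> R by rewrite intr_eq0.
have dc (t : R) : is_derive t 1 (fun t => c / k%:~R * sin (k%:~R * t))
    (c * cos (k%:~R * t)).
  by rewrite -[c in c * cos _](divfK k0'); exact: is_derive_sinM.
rewrite (circle_int_derive dc); last exact: continuous_cosM.
by rewrite mulrN sinN sin_int_pi oppr0 !mulr0 subrr.
Qed.

Lemma circle_int_odd (h : R -> R) : (forall t, h (- t) = - h t) ->
  circle_int h = 0.
Proof.
move=> hN; rewrite /circle_int.
under eq_Rintegral do rewrite hN subrr.
by rewrite /Rintegral integral0.
Qed.

Lemma Re_realM (c : R) (z : R[i]) : complex.Re (c%:C * z) = c * complex.Re z.
Proof. by case: z => x y /=; rewrite mul0r subr0. Qed.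

Lemma Im_realM (c : R) (z : R[i]) : complex.Im (c%:C * z) = c * complex.Im z.
Proof. by case: z => x y /=; rewrite mul0r addr0. Qed.

(** The derivatives of the Chebyshev polynomials are orthogonal on the ellipse.
    The real factor [c] serves to absorb normalization constants.  The boundary
    integrand of the real part is a combination of [cos ((n - m) t)] and
    [cos ((n + m) t)]; the mean of the first one survives only for [n = m], and
    that of the second one only for [n = m = 0], where its coefficient is [0].
    The boundary integrand of the imaginary part is odd in [t]. *)
Lemma iint_deriv_chebT a b s (c : R) n m : a = cosh s -> b = sinh s -> 0 < a -> 0 < b ->
  iint [set z | b ^+ 2 * complex.Re z ^+ 2 + a ^+ 2 * complex.Im z ^+ 2
                < a ^+ 2 * b ^+ 2]
    (fun z => c%:C * ((deriv (chebT R n)).[z] * ((deriv (chebT R m)).[z])^*)) =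
  (c * (m%:R * pi * cosh (m%:R * s) * sinh (m%:R * s) * (n == m)%:R))%:C.
Proof.
move=> aE bE a0 b0.
have [u [v [uvE uvE' uv1 uv2]]] := cauchy_riemann (chebT R n).
have [p [q [pqE pqE' pq1 pq2]]] := cauchy_riemann (chebT R m).
have uvT t : (bieval u (a * cos t) (b * sin t) = cosh (n%:R * s) * cos (n%:R * t))
           * (bieval v (a * cos t) (b * sin t) = sinh (n%:R * s) * sin (n%:R * t)).
  by have := chebT_ellipse n t s; rewrite -aE -bE uvE => -[-> ->].
have pqT t : (bieval p (a * cos t) (b * sin t) = cosh (m%:R * s) * cos (m%:R * t))
           * (bieval q (a * cos t) (b * sin t) = sinh (m%:R * s) * sin (m%:R * t)).
  by have := chebT_ellipse m t s; rewrite -aE -bE pqE => -[-> ->].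
have dp (t : R) : is_derive t 1 (fun t => bieval p (a * cos t) (b * sin t))
    (- (cosh (m%:R * s) * m%:R * sin (m%:R * t))).
  by under eq_fun do rewrite pqT; exact: is_derive_cosM.
have dq (t : R) : is_derive t 1 (fun t => bieval q (a * cos t) (b * sin t))
    (sinh (m%:R * s) * m%:R * cos (m%:R * t)).
  by under eq_fun do rewrite pqT; exact: is_derive_sinM.
have dNq (t : R) : is_derive t 1 (fun t => bieval (- q) (a * cos t) (b * sin t))
    (- (sinh (m%:R * s) * m%:R * cos (m%:R * t))).
  by under eq_fun do rewrite bievalN; exact: is_deriveN.
have half (x y : R) : x *+ 2 = y *+ 2 -> x = y.
  by rewrite !mulr2n => xy; lra.
rewrite /iint.
rewrite -[RHS]complexr0.
apply: congr2.
- transitivity (c * ellipse_int a b (dx u * dx p + dx v * dx q)).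
    rewrite -ellipse_intZ//; apply: eq_Rintegral => z _.
    by rewrite Re_realM uvE' pqE' /= !bievalE hornerC; ring.
  congr (c * _); apply: half; rewrite (green_cauchy_riemann a0 b0 pq1 pq2 uv1 uv2 dp dq).
  (* Product-to-sum formulas. *)
  pose A := m%:R * (cosh (n%:R * s) * sinh (m%:R * s) + sinh (n%:R * s) * cosh (m%:R * s)) / 2.
  pose B := m%:R * (cosh (n%:R * s) * sinh (m%:R * s) - sinh (n%:R * s) * cosh (m%:R * s)) / 2.
  transitivity (circle_int (fun t => A * cos ((n%:Z - m%:Z)%:~R * t)
                                   + B * cos ((n%:Z + m%:Z)%:~R * t))).
    congr circle_int; apply/funext => t; rewrite !uvT rmorphB rmorphD/=.
    rewrite mulrBl mulrDl cosB cosD /A /B -!pmulrn; by field.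
  rewrite circle_intD; [|exact: continuous_cosM|exact: continuous_cosM].
  rewrite !circle_int_cos subr_eq0 eqz_nat -PoszD eqz_nat addn_eq0.
  case: (eqVneq n m) => [nm|nm]; last first.
    case: (eqVneq m 0%N) => [m0|m0]; last by rewrite andbF/= !mulr0 addr0 mul0rn.
    by rewrite /A /B m0 !mul0r addr0 mul0rn.
  by rewrite /A /B nm; case: (_ && _); field.
(* The imaginary part is the real part with [i g] in place of [g]. *)
- transitivity (c * ellipse_int a b (dx u * dx (- q) + dx v * dx p)).
    rewrite -ellipse_intZ//; apply: eq_Rintegral => z _.
    by rewrite Im_realM uvE' pqE' /= dxN !bievalE hornerC; ring.
  rewrite -[RHS](mulr0 c); congr (c * _); apply: half; rewrite mul0rn.
  have Nq1 : dx (- q) = dy p by rewrite pq2 dxN.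
  have Nq2 : dy (- q) = - dx p by rewrite dyN pq1.
  rewrite (green_cauchy_riemann a0 b0 Nq1 Nq2 uv1 uv2 dNq dp).
  apply: circle_int_odd => t; rewrite !uvT !mulrN !cosN !sinN; ring.
Qed.

End ChebyshevOnEllipse.

(** * Orthonormality *)

Section Orthonormality.
Variable R : realType.

Lemma realM_conj_realM (c d : R) (z w : R[i]) :
  (c%:C * z) * (d%:C * w)^* = (c * d)%:C * (z * w^*).
Proof.
have -> : (d%:C * w)^*%R = d%:C * w^*.
  by rewrite rmorphM; congr (_ * _); exact: conjc_real.
by rewrite mulrACA -rmorphM.
Qed.

(** [a + b] and [a - b] are inverse to each other, as [a^2 - b^2 = 1]. *)
Lemma cosh_sinh_ln (a b : R) : 0 < b -> b < a -> a ^+ 2 - b ^+ 2 = 1 ->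
  cosh (ln (a + b)) = a /\ sinh (ln (a + b)) = b.
Proof.
move=> b0 ba ab; have ab0 : 0 < a + b by rewrite addr_gt0// (lt_trans b0).
have abV : (a + b)^-1 = a - b.
  by apply: (mulfI (lt0r_neq0 ab0)); rewrite divff ?gt_eqF// -ab; ring.
by rewrite /cosh /sinh expRN lnK ?posrE// abV; split; field.
Qed.

Lemma cosh_mul_sinh (a b : R) n : 0 < b -> b < a -> let rho := (a + b) ^+ 2 in
  cosh (n%:R * ln (a + b)) * sinh (n%:R * ln (a + b)) = (rho ^+ n - rho ^- n) / 4.
Proof.
move=> b0 ba /=; have ab0 : 0 < a + b by rewrite addr_gt0// (lt_trans b0).
rewrite /cosh /sinh expRN expRM_natl lnK ?posrE// -!exprM mulnC exprM.
by field; rewrite expf_neq0// gt_eqF.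
Qed.

End Orthonormality.

Unset Implicit Arguments.

Theorem theorem11 (R : realType) (a b : R)
    (hb : 0 < b) (hba : b < a) (hab : a ^+ 2 - b ^+ 2 = 1) :
  let D : set R[i] := [set z | b ^+ 2 * complex.Re z ^+ 2
                             + a ^+ 2 * complex.Im z ^+ 2 < a ^+ 2 * b ^+ 2] in
  let rho : R := (a + b) ^+ 2 in
  let P (n : nat) (z : R[i]) : R[i] :=
    (2 * Num.sqrt (n.+1%:R / pi)
       * (rho ^+ n.+1 - rho ^- n.+1) `^ (- (1 / 2)))%:C * (chebU R n).[z] in
  (forall n m : nat, iint D (fun z => P n z * (P m z)^*) = (n == m)%:R)
  /\
  (forall n : nat,
     iint D (fun z => `| (chebT R n)^`().[z] | ^+ 2)
       = (n%:R * pi / 4 * (rho ^+ n - rho ^- n))%:C).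
Proof.
move=> D rho P.
have ha : 0 < a by exact: lt_trans hba.
have [/esym aE /esym bE] := cosh_sinh_ln hb hba hab.
have gram c n m : iint D (fun z => c%:C *
    ((chebT R n)^`().[z] * ((chebT R m)^`().[z])^*)) =
    (c * (m%:R * pi * ((rho ^+ m - rho ^- m) / 4) * (n == m)%:R))%:C.
  rewrite (iint_deriv_chebT _ _ _ aE bE ha hb).
  by rewrite -(cosh_mul_sinh _ hb hba) !mulrA.
split=> [n m|n]; last first.
  have <- : 1 * (n%:R * pi * ((rho ^+ n - rho ^- n) / 4) * (n == n)%:R)
      = n%:R * pi / 4 * (rho ^+ n - rho ^- n).
    by rewrite eqxx mulr1; ring.
  rewrite -gram; congr iint; apply/funext => z.
  by rewrite mul1r sqr_normc.
(* Positivity, because [rho = 1 + 2 b^2 + 2 a b > 1]. *)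
have X0 k : 0 < rho ^+ k.+1 - rho ^- k.+1.
  have rho1 : 1 < rho.
    have := mulr_gt0 ha hb; rewrite /rho => ab0.
    have -> : (a + b) ^+ 2 = 1 + (b ^+ 2 *+ 2 + a * b *+ 2) by rewrite -hab; ring.
    by rewrite ltrDl addr_gt0// pmulrn_lgt0// exprn_gt0.
  have r1 : 1 < rho ^+ k.+1 by rewrite exprn_egt1.
  by rewrite subr_gt0 (lt_trans _ r1)// invf_lt1// (lt_trans _ r1).
pose K k := 2 * Num.sqrt (k.+1%:R / pi) * (rho ^+ k.+1 - rho ^- k.+1) `^ (- (1 / 2)) : R.
have PE k z : P k z = (K k / k.+1%:R)%:C * (chebT R k.+1)^`().[z].
  by rewrite /P -/(K k) /chebU hornerZ mulrA [in RHS]rmorphM fmorphV rmorph_nat.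
transitivity (iint D (fun z => ((K n / n.+1%:R) * (K m / m.+1%:R))%:C *
    ((chebT R n.+1)^`().[z] * ((chebT R m.+1)^`().[z])^*))).
  by congr iint; apply/funext => z; rewrite !PE realM_conj_realM.
rewrite gram eqSS; have [<-|_] := eqVneq n m; last by rewrite !mulr0.
rewrite -[RHS](rmorph1 (real_complex R)); congr (_%:C); rewrite mulr1.
(* The square of the normalizing constant; the exponents [-1/2] add up to [-1]. *)
have K2 : K n * K n = 4 * (n.+1%:R / pi) / (rho ^+ n.+1 - rho ^- n.+1).
  have -> : K n * K n = 4 * (Num.sqrt (n.+1%:R / pi)) ^+ 2 *
    ((rho ^+ n.+1 - rho ^- n.+1) `^ (- (1 / 2)) * (rho ^+ n.+1 - rho ^- n.+1) `^ (- (1 / 2))).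
    rewrite /K; ring.
  rewrite sqr_sqrtr ?divr_ge0 ?pi_ge0// -powRD; last by rewrite (gt_eqF (X0 n)) implybT.
  by rewrite -opprD -splitr powR_inv1 ?(ltW (X0 n)).
rewrite (mulrACA (K n)) K2.
move: (X0 n) (pi_gt0 R); move: (_ - _) pi => X q X_gt0 q_gt0.
by field; rewrite addrC natr1 pnatr_eq0 !gt_eqF.
Qed.
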